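(* Let $G$ be a matroid on $[n]$ with no loops and no multiple points. Then $G$ is line-closed if and only if, for every linear ordering of $[n]$, the set of nbb sets of $G$ coincides with the set of nbc sets of $G$ (both computed with respect to that ordering).
   Context: $\operatorname{cl}$ denotes matroid closure. A subset $S\subseteq[n]$ is line-closed if $\operatorname{cl}(\{i,j\})\subseteq S$ for all $i,j\in S$; $G$ is line-closed if every line-closed set is closed (i.e. equals its closure). The line-closure $\operatorname{lc}(S)$ is the intersection of all line-closed sets containing $S$. Given a linear order on $[n]$: a broken circuit is $C-\min(C)$ for a circuit $C$; an nbc set is a subset containing no broken circuit; a subset $S=\{i_1<\dots<i_p\}$ (increasing in the given order) is nbb if $i_k=\min\operatorname{lc}(\{i_k,\dots,i_p\})$ for each $1\le k\le p$, minima taken in the given order. *)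

(* Defs.v *)
From mathcomp Require Import all_boot.

Set Implicit Arguments.
Unset Strict Implicit.
Unset Printing Implicit Defensive.

Record matroid (T : finType) := Matroid {
  indep : pred {set T};
  indep_set0 : indep set0;
  indep_sub : forall I J : {set T}, I \subset J -> indep J -> indep I;
  indep_aug : forall I J : {set T}, indep I -> indep J -> #|I| < #|J| ->
    exists2 x, x \in J :\: I & indep (x |: I)
}.

Section Matroid.
Variables (T : finType) (G : matroid T).
Implicit Types (S L B C : {set T}) (i j m : T).

Definition circuit C : bool := minset (fun D => ~~ indep G D) C.

Definition rank S : nat := \max_(I : {set T} | indep G I && (I \subset S)) #|I|.

Definition cl S : {set T} := [set x | rank (x |: S) == rank S].

Definition no_loops : Prop := forall i, ~~ circuit [set i].

Definition no_multiple_points : Prop :=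
  forall i j, i != j -> ~~ circuit [set i; j].

Definition line_closed S : bool :=
  [forall i in S, forall j in S, cl [set i; j] \subset S].

Definition line_closed_matroid : Prop :=
  forall S, line_closed S -> cl S = S.

Definition lc S : {set T} :=
  \bigcap_(L : {set T} | line_closed L && (S \subset L)) L.

Definition linear_order (le : rel T) : Prop :=
  [/\ reflexive le, antisymmetric le, transitive le & total le].

Variable le : rel T.

Definition is_min S m : bool := (m \in S) && [forall x in S, le m x].

(* [is_min] is relational, but circuits are nonempty, so for a linear order
   each circuit has exactly one minimum and yields exactly one broken circuit. *)
Definition broken_circuit B : bool :=
  [exists C : {set T}, exists m : T,
     [&& circuit C, is_min C m & B == C :\ m]].

Definition nbc S : bool :=
  [forall B : {set T}, broken_circuit B ==> ~~ (B \subset S)].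

(* If S = {i_1 < ... < i_p} and i = i_k, then {i_k, ..., i_p} is the set of
   the j in S with i <= j. *)
Definition nbb S : bool :=
  [forall i in S, is_min (lc [set j in S | le i j]) i].

End Matroid.

(* Main.v *)
Require Import Defs.
From mathcomp Require Import all_boot.

(** Always [lc S \subset cl S], with equality when [G] is line-closed, and the
    nbc sets are those satisfying the nbb condition with [cl] in place of [lc];
    this gives the forward direction.  Conversely, let [S] be line-closed and
    [x] in [cl S :\: S].  Order the ground set with [x] first, and let [I] be
    the greedy basis of [S], i.e. those [i] in [S] outside the closure of the
    smaller elements of [S].  Then [I] is nbc in the restriction of [G] to [S],
    and hence nbb in [G], because line-closures of subsets of [I] stay in [S].
    But [x] lies in [cl I], so [I] contains a broken circuit with missing
    minimum [x]. *)

Set Implicit Arguments.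
Unset Strict Implicit.
Unset Printing Implicit Defensive.

(** * Matroid closure, circuits and line-closure *)

Section Closure.
Variables (T : finType) (G : matroid T).
Implicit Types (A B C I J S : {set T}) (i x z : T).

Definition basis A B := [&& indep G B, B \subset A & #|B| == rank G A].

Lemma leq_rank A B : indep G B -> B \subset A -> #|B| <= rank G A.
Proof.
by move=> iB sBA; apply: (@bigmax_sup _ B); rewrite ?iB.
Qed.

Lemma basis_extend A B : indep G B -> B \subset A ->
  exists2 B' : {set T}, B \subset B' & basis A B'.
Proof.
move=> iB sBA.
pose P I := [&& indep G I, B \subset I & I \subset A].
have PB : P B by rewrite /P iB subxx.
case: (@arg_maxnP _ B P (fun I : {set T} => #|I|) PB) => B' /and3P[iB' sBB' sB'A] maxB'.
exists B' => //; rewrite /basis iB' sB'A eqn_leq leq_rank //=.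
apply/bigmax_leqP => J /andP[iJ sJA]; rewrite leqNgt; apply/negP => ltB'J.
have [z /setDP[zJ zB'] izB'] := indep_aug iB' iJ ltB'J.
have /maxB' : P (z |: B').
  rewrite /P izB' subUset sub1set (subsetP sJA) // sB'A andbT.
  by rewrite (subset_trans sBB') ?subsetUr.
by rewrite /= cardsU1 zB' ltnn.
Qed.

Lemma basis_exists A : exists B, basis A B.
Proof. by have [B] := basis_extend (indep_set0 G) (sub0set A); exists B. Qed.

(** If [x |: B] is independent with [x] outside [B], the rank rises. Otherwise a larger independent
    set in [x |: A] would augment [B] by [x] or by an element of [A], and both are impossible. *)
Lemma cl_basis A B x : basis A B ->
  (x \in cl G A) = (x \in B) || ~~ indep G (x |: B).
Proof.
case/and3P=> iB sBA /eqP cardB; rewrite inE.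
have sAxA : A \subset x |: A by rewrite subsetUr.
apply/eqP/orP => [rk | depB].
  have [xB|xB] := boolP (x \in B); [by left | right].
  apply/negP => /(@leq_rank (x |: A)).
  by rewrite setUS // rk -cardB cardsU1 xB ltnn => /(_ isT).
apply/eqP; rewrite eqn_leq -{2}cardB leq_rank ?andbT ?(subset_trans sBA) //.
apply/bigmax_leqP => J /andP[iJ sJ]; rewrite leqNgt -cardB; apply/negP => ltBJ.
have [z /setDP[zJ zB] izB] := indep_aug iB iJ ltBJ.
have /setU1P[zx|zA] := subsetP sJ _ zJ.
  by case: depB; rewrite -zx ?izB // (negPf zB).
have /leq_rank := izB => /(_ A); rewrite subUset sub1set zA sBA => /(_ isT).
by rewrite -cardB cardsU1 zB ltnn.
Qed.

Lemma sub_cl A : A \subset cl G A.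
Proof.
by apply/subsetP => x xA; rewrite inE (setUidPr _) // sub1set.
Qed.

Lemma clS A B : A \subset B -> cl G A \subset cl G B.
Proof.
move=> sAB; have [I bI] := basis_exists A.
have /and3P[iI sIA _] := bI.
have [J sIJ bJ] := basis_extend iI (subset_trans sIA sAB).
apply/subsetP => x; rewrite (cl_basis x bI) (cl_basis x bJ).
case/orP => [/(subsetP sIJ)->// | dep]; apply/orP; right.
by apply: contra dep; apply: indep_sub; rewrite setUS.
Qed.

(** By augmentation, a basis of [A] is still a basis of [cl G A]. *)
Lemma cl_cl A : cl G (cl G A) = cl G A.
Proof.
have [B bB] := basis_exists A; have /and3P[iB sBA _] := bB.
have sBcl := subset_trans sBA (sub_cl A).
have bBcl : basis (cl G A) B.
  rewrite /basis iB sBcl eqn_leq leq_rank //=.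
  apply/bigmax_leqP => J /andP[iJ sJ]; rewrite leqNgt; apply/negP => ltBJ.
  have [z /setDP[zJ zB] izB] := indep_aug iB iJ ltBJ.
  by have := subsetP sJ _ zJ; rewrite (cl_basis z bB) (negPf zB) izB.
by apply/setP => x; rewrite (cl_basis x bB) (cl_basis x bBcl).
Qed.

Lemma cl_sub_cl A B : A \subset cl G B -> cl G A \subset cl G B.
Proof. by move/clS; rewrite cl_cl. Qed.

Lemma dependent_circuit A : ~~ indep G A ->
  exists2 C, circuit G C & C \subset A.
Proof. by case/(@minset_exists _ (fun D => ~~ indep G D)) => C; exists C. Qed.

Lemma cl_circuit A x : x \in cl G A -> x \notin A ->
  exists C, [/\ circuit G C, x \in C & C \subset x |: A].
Proof.
move=> xcl xA; have [B bB] := basis_exists A; have /and3P[iB sBA _] := bB.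
have xB : x \notin B by apply: contra xA; apply: subsetP.
have := xcl; rewrite (cl_basis x bB) (negPf xB) /=.
case/dependent_circuit => C cC sC; exists C; split=> //.
  (* A circuit avoiding [x] would lie in the independent set [B]. *)
  apply: contraT => xC; case/minsetP: cC => /negP[]; apply: indep_sub iB.
  by apply/subsetP => z zC; case/setU1P: (subsetP sC _ zC) xC => // <- /negP.
by apply: (subset_trans sC); rewrite setUS.
Qed.

(** By minimality [C :\ x] is independent, hence its own basis. *)
Lemma circuit_cl C x : circuit G C -> x \in C -> x \in cl G (C :\ x).
Proof.
move=> /minsetP[dC minC] xC.
have iCx : indep G (C :\ x).
  apply: contraT => dCx; have eqC := minC _ dCx (subD1set C x).
  by have := setD11 x C; rewrite eqC xC.
have bCx : basis (C :\ x) (C :\ x).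
  rewrite /basis iCx subxx eqn_leq leq_rank //=.
  by apply/bigmax_leqP => J /andP[_ /subset_leq_card].
by rewrite (cl_basis x bCx) setD1K // dC orbT.
Qed.

Lemma cl_line_closed A : line_closed G (cl G A).
Proof.
apply/forall_inP => i iA; apply/forall_inP => j jA.
by apply: cl_sub_cl; apply/subsetP => z /set2P[]->.
Qed.

Lemma lc_min S A : line_closed G A -> S \subset A -> lc G S \subset A.
Proof. by move=> lA sSA; apply: bigcap_inf; rewrite lA. Qed.

Lemma sub_lc S : S \subset lc G S.
Proof. by apply/bigcapsP => A /andP[]. Qed.

Lemma lc_sub_cl S : lc G S \subset cl G S.
Proof. exact: lc_min (cl_line_closed S) (sub_cl S). Qed.

Lemma lc_line_closed S : line_closed G (lc G S).
Proof.
apply/forall_inP => i /bigcapP iS; apply/forall_inP => j /bigcapP jS.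
apply/bigcapsP => A lA; have /andP[/forall_inP/(_ i (iS A lA)) lAi _] := lA.
exact: (forall_inP lAi) (jS A lA).
Qed.

Lemma lc_eq_cl S : line_closed_matroid G -> lc G S = cl G S.
Proof.
move=> lG; apply/eqP; rewrite eqEsubset lc_sub_cl /=.
by rewrite -(lG _ (lc_line_closed S)) clS ?sub_lc.
Qed.

End Closure.

(** * Minima, and nbb versus nbc sets in a line-closed matroid *)

Section Orders.
Variables (T : finType) (le : rel T).
Hypothesis le_lin : linear_order le.

Lemma exists_is_min (A : {set T}) : A != set0 -> exists m, is_min le A m.
Proof.
have [le_refl _ le_trans le_total] := le_lin.
(* An element of [A] with the fewest elements below it is the minimum. *)
case/set0Pn => a aA; pose f m := #|[set j | le j m]|.
case: (@arg_minnP _ a (mem A) f aA) => m mA minm.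
exists m; rewrite /is_min [m \in A]mA; apply/forall_inP => x xA.
case/orP: (le_total m x) => // le_xm.
have sub : [set j | le j x] \subset [set j | le j m].
  by apply/subsetP => j; rewrite !inE => /le_trans; apply.
have : [set j | le j x] == [set j | le j m] by rewrite eqEcard sub minm.
by move/eqP/setP/(_ m); rewrite !inE le_refl.
Qed.

(** A broken circuit [C :\ m] in [S] with minimum [i] puts [m], which is below [i], in the closure
    of the elements of [S] from [i] on. Conversely, an [x] below [i] in that closure is the minimum
    of a circuit whose other elements lie in [S]. *)
Lemma line_closed_nbb_nbc (G : matroid T) (S : {set T}) :
  no_loops G -> line_closed_matroid G -> nbb G le S = nbc G le S.
Proof.
have [le_refl le_anti le_trans le_total] := le_lin.
move=> noloop lG; apply/idP/idP => [/forall_inP nbbS | /forallP nbcS].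
  apply/forallP => B; apply/implyP => /existsP[C /existsP[m]].
  case/and3P=> cC /andP[mC /forall_inP minm] /eqP->{B}; apply/negP => sBS.
  have nzB : C :\ m != set0.
    apply: contraNneq (noloop m) => B0.
    by rewrite -(setD1K mC) B0 setU0 in cC.
  have [i /andP[iB /forall_inP mini]] := exists_is_min nzB.
  have /andP[_ /forall_inP minlc] := nbbS i (subsetP sBS _ iB).
  have le_im : le i m.
    apply: minlc; rewrite lc_eq_cl //.
    apply: (subsetP (clS _ _)) (circuit_cl cC mC).
    by apply/subsetP => j jB; rewrite inE (subsetP sBS) ?mini.
  have [neq_im iC] := setD1P iB.
  by case/eqP: neq_im; apply: le_anti; rewrite le_im minm.
apply/forall_inP => i iS; rewrite lc_eq_cl //; set A := [set j in S | le i j].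
have iA : i \in A by rewrite inE iS le_refl.
rewrite /is_min (subsetP (sub_cl G A)) //=; apply/forall_inP => x xcl.
apply: contraT => nle_ix; have le_xi : le x i.
  by have := le_total i x; rewrite (negPf nle_ix).
have xA : x \notin A by rewrite inE (negPf nle_ix) andbF.
have [C [cC xC sC]] := cl_circuit xcl xA.
have bB : broken_circuit G le (C :\ x).
  apply/existsP; exists C; apply/existsP; exists x.
  rewrite cC eqxx andbT /is_min xC; apply/forall_inP => j jC.
  case/setU1P: (subsetP sC _ jC) => [->|]; first exact: le_refl.
  by rewrite inE => /andP[_]; apply: le_trans.
have /implyP/(_ bB)/negP[] := nbcS (C :\ x).
apply/subsetP => j /setD1P[jx jC].
by case/setU1P: (subsetP sC _ jC) jx => [->|]; rewrite ?eqxx // inE => /andP[].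
Qed.

End Orders.

(** * The greedy basis of a set for an order given by positions *)

Section Greedy.
Variables (T : finType) (G : matroid T) (pos : T -> nat).
Hypothesis pos_inj : injective pos.
Variable S : {set T}.

Let le : rel T := fun i j => pos i <= pos j.

Definition greedy_basis : {set T} :=
  [set i in S | i \notin cl G [set j in S | pos j < pos i]].

Lemma pos_linear_order : linear_order le.
Proof.
split=> [i|i j|j i k|i j]; rewrite /le ?leqnn ?leq_total //.
  by rewrite -eqn_leq => /eqP/pos_inj.
exact: leq_trans.
Qed.

Lemma greedy_basis_cl : S \subset cl G greedy_basis.
Proof.
(* Strong induction on position: a discarded [s] lies in the closure of smaller elements of [S],
   which are already spanned. *)
apply/subsetP => s; move: {2}(pos s).+1 (ltnSn (pos s)) => m.
elim: m s => // m IHm s lt_sm sS.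
have [sI|] := boolP (s \in greedy_basis); first exact: subsetP (sub_cl _ _) _ sI.
rewrite inE sS negbK; apply/subsetP/cl_sub_cl/subsetP => j.
by rewrite inE => /andP[jS lt_js]; apply: IHm => //; apply: leq_trans lt_js _.
Qed.

(** If some [y] in [lc G J] came before [i], it would close a circuit with elements of [J]. As [y]
    is in [S], the last element [c] of that circuit would lie in the closure of smaller elements of
    [S], against its greedy choice. *)
Lemma greedy_basis_nbb : no_loops G -> line_closed G S ->
  nbb G le greedy_basis.
Proof.
move=> noloop lS; apply/forall_inP => i iI; set J := [set j in _ | _].
have iJ : i \in J by rewrite inE iI /le leqnn.
rewrite /is_min (subsetP (sub_lc G J)) //; apply/forall_inP => y ylc.
have sIS : greedy_basis \subset S by apply/subsetP => j; rewrite inE => /andP[].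
have sJI : J \subset greedy_basis by apply/subsetP => j; rewrite inE => /andP[].
have yS := subsetP (lc_min lS (subset_trans sJI sIS)) _ ylc.
rewrite /le leqNgt; apply/negP => lt_yi.
have yJ : y \notin J by rewrite inE /le leqNgt lt_yi andbF.
have [C [cC yC sC]] := cl_circuit (subsetP (lc_sub_cl G J) _ ylc) yJ.
case: (@arg_maxnP _ y (mem C) pos yC) => c cinC maxc.
(* All of [J] comes after [y], so if [y] were last in [C], then [C] would be a loop. *)
have neq_cy : c != y.
  apply: contraNneq (noloop y) => eq_cy; rewrite eq_cy in maxc.
  suff -> : [set y] = C by [].
  apply/eqP; rewrite eqEsubset sub1set yC; apply/subsetP => z zC.
  case/setU1P: (subsetP sC _ zC) => [->|]; first exact: set11.
  case/setIdP=> _ le_iz.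
  by have := leq_trans lt_yi (leq_trans le_iz (maxc z zC)); rewrite ltnn.
have cI : c \in greedy_basis.
  by case/setU1P: (subsetP sC _ cinC) neq_cy => [->|/(subsetP sJI)]; rewrite ?eqxx.
have := cI; rewrite inE => /andP[_]; case/negP.
apply: (subsetP (clS _ _)) (circuit_cl cC cinC).
apply/subsetP => z /setD1P[neq_zc zC]; rewrite inE ltn_neqAle (maxc z zC : pos z <= pos c) andbT.
rewrite (inj_eq pos_inj) neq_zc andbT.
by case/setU1P: (subsetP sC _ zC) => [->|/(subsetP sJI)/(subsetP sIS)].
Qed.

Lemma greedy_basis_not_nbc x : x \in cl G S -> x \notin S ->
  (forall j, pos x <= pos j) -> ~~ nbc G le greedy_basis.
Proof.
move=> xcl xS minx; have xI : x \notin greedy_basis by rewrite inE (negPf xS).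
have [C [cC xC sC]] :=
  cl_circuit (subsetP (cl_sub_cl greedy_basis_cl) _ xcl) xI.
apply/forallPn; exists (C :\ x); rewrite negb_imply negbK subDset sC andbT.
apply/existsP; exists C; apply/existsP; exists x.
rewrite cC eqxx /is_min xC !andbT; apply/forall_inP => j _; exact: minx.
Qed.

End Greedy.

Theorem theorem2p13 (n : nat) (G : matroid 'I_n)
    (Hloops : no_loops G) (Hmult : no_multiple_points G) :
  line_closed_matroid G <->
  (forall le : rel 'I_n, linear_order le ->
     [set S : {set 'I_n} | nbb G le S] = [set S : {set 'I_n} | nbc G le S]).
Proof.
split=> [lG le le_lin | eq_nb S lS].
  by apply/setP => S; rewrite !inE line_closed_nbb_nbc.
apply/eqP; rewrite eqEsubset sub_cl andbT; apply/subsetP => x xcl.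
(* The successor in [j.+1] reserves position 0 for [x], which makes [x] first and keeps [pos]
   injective. *)
apply: contraT => xS; pose pos (j : 'I_n) := if j == x then 0 else j.+1.
have pos_inj : injective pos.
  move=> i j; rewrite /pos; case: eqP => [->|_]; case: eqP => [->|_] //.
  by case=> /val_inj.
have /setP/(_ (greedy_basis G pos S)) := eq_nb _ (pos_linear_order pos_inj).
rewrite !inE greedy_basis_nbb //.
have minx j : pos x <= pos j by rewrite /pos eqxx.
by rewrite (negPf (greedy_basis_not_nbc xcl xS minx)).
Qed.
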